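(* Let $\mathsf{p}$ be any probability distribution on $\mathbb{R}^n$ supported on vectors of Euclidean norm at most $1$, and let $v_1,\dots,v_T$ be sampled i.i.d. from $\mathsf{p}$ and revealed one at a time. There is an online algorithm choosing signs $\chi_1,\dots,\chi_T\in\{\pm1\}$ such that, with high probability, the discrepancy vectors $d_t=\sum_{\tau=1}^t \chi_\tau v_\tau$ satisfy $\|d_t\|_\infty = O(\log^4(nT))$ for all $t\in[T]$.
   Context: Online vector balancing: at time $t$ the vector $v_t$ arrives and the algorithm must irrevocably choose $\chi_t\in\{\pm1\}$ using only $v_1,\dots,v_t$, its earlier choices, knowledge of the distribution $\mathsf{p}$, and possibly internal randomness. ''With high probability'' refers to the randomness of the inputs and of the algorithm. The $O(\cdot)$ hides a universal constant independent of $n,T,\mathsf{p}$. *)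

(* Defs.v *)
From HB Require Import structures.
From mathcomp Require Import all_boot all_order all_algebra.
From mathcomp Require Import all_classical all_reals all_analysis.

Set Implicit Arguments.
Unset Strict Implicit.
Unset Printing Implicit Defensive.
Import Order.TTheory GRing.Theory Num.Theory.

Local Open Scope classical_set_scope.
Local Open Scope ring_scope.

(* R^n is n.-tuple R, because the library equips tuples (and not row vectors)
   with a sigma-algebra: the product of the Borel sigma-algebras. *)

Definition l2norm (R : realType) (n : nat) (v : n.-tuple R) : R :=
  Num.sqrt (\sum_(i < n) tnth v i ^+ 2).

Definition linfnorm (R : realType) (n : nat) (v : n.-tuple R) : R :=
  \big[Num.max/0]_(i < n) `|tnth v i|.

Definition sign_of (R : realType) (b : bool) : R := if b then 1 else -1.

Definition iid (R : realType) (d d' : measure_display) (Omega : measurableType d)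
    (P : probability Omega R) (S : measurableType d') (p : probability S R)
    (I : finType) (V : I -> {RV P >-> S}) : Prop :=
  (forall i A, measurable A -> distribution P (V i) A = p A) /\
  (forall (J : {set I}) (A : I -> set S), (forall i, measurable (A i)) ->
     P (\bigcap_(i in [set` J]) (V i @^-1` A i)) =
     (\prod_(i in J) P (V i @^-1` A i))%E).

(* All internal randomness is one seed drawn at the start from seed_law; the
   choice at time t+1 is a function of the seed, of the t+1 vectors revealed so
   far and of the t earlier choices. *)
Record online_alg (R : realType) (n : nat) := OnlineAlg {
  seed_display : measure_display ;
  seed : measurableType seed_display ;
  seed_law : probability seed R ;
  rule : forall t : nat,
    seed * t.+1.-tuple (n.-tuple R) * t.-tuple bool -> bool ;
  measurable_rule : forall t : nat, measurable_fun setT (@rule t) }.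

Definition tuple_prefix (X : Type) (t : nat) (v : t.+1.-tuple X) : t.-tuple X :=
  [tuple tnth v (widen_ord (leqnSn t) i) | i < t].

Fixpoint choices (R : realType) (n : nat) (A : online_alg R n) (s : seed A)
    (t : nat) : t.-tuple (n.-tuple R) -> t.-tuple bool :=
  match t with
  | 0 => fun _ => [tuple]
  | t'.+1 => fun v =>
      let past := choices s (tuple_prefix v) in
      [tuple of rcons past (rule (s, v, past))]
  end.

(* The sum of the first t+1 signed vectors: t : 'I_T stands for time t+1. *)
Definition discrepancy (R : realType) (n T : nat) (chi : T.-tuple bool)
    (v : T.-tuple (n.-tuple R)) (t : 'I_T) : n.-tuple R :=
  [tuple \sum_(tau < T | (tau <= t)%N)
           sign_of R (tnth chi tau) * tnth (tnth v tau) i | i < n].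

(* Main.v *)
Require Import Defs.
From HB Require Import structures.
From mathcomp Require Import all_boot all_order all_algebra.
From mathcomp Require Import all_classical all_reals all_analysis.
From mathcomp Require Import measurable_realfun lra ring.

Set Implicit Arguments.
Unset Strict Implicit.
Unset Printing Implicit Defensive.
Import Order.TTheory GRing.Theory Num.Theory.
Local Open Scope classical_set_scope.
Local Open Scope ring_scope.

(* The algorithm is the self-balancing walk of Alweiss, Liu and Sawhney: with
   w the current signed sum, v arrives and gets the sign +1 with probability
   (1 - <w, v> / c) / 2, where c is of order log (nT).  As long as every
   |<w, v>| stays below c, the moment generating function satisfies
     E exp <u, w_t> <= exp (2 c |u|^2)   for |u| <= 1/2:
   averaging over the last sign replaces u by u - <u, v> v / c, and the squared
   norm lost in doing so pays for the variance <u, v>^2 of the step.  A Chernoff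
   bound with u along v, respectively along a basis vector, then bounds both the
   probability that |<w, v>| ever exceeds c and the probability that a
   coordinate of w does.  This holds for every fixed sequence of vectors of norm
   at most 1, so Fubini concludes.

   The signs are generated from a single uniform seed s < T ^ T, whose base-T
   digits serve as independent coins; rounding each probability to a multiple of
   1/T costs a factor exp (1/T) per step, hence at most e overall. *)

(** * An exponential inequality and averages over seeds *)

Lemma expR_le_quadratic (R : realType) (x : R) :
  x <= 2^-1 -> expR x <= 1 + x + 2 * x ^+ 2.
Proof.
move=> x2; have x1 : 0 < 1 - x by lra.
have e1 : expR x <= (1 - x)^-1.
  rewrite -[x in expR x]opprK expRN lef_pV2 ?posrE ?expR_gt0//.
  exact: expR_ge1Dx.
apply: le_trans e1 _; rewrite -div1r ler_pdivrMr//.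
(* With the denominator cleared, what remains is [x ^+ 2 * (1 - 2 * x) >= 0]. *)
have := sqr_ge0 x; nra.
Qed.

Lemma sum_ord_mul (R : realType) (m k : nat) (F : nat -> R) :
  \sum_(s < m * k) F s = \sum_(a < m) \sum_(b < k) F (a * k + b)%N.
Proof.
elim: m => [|m IH]; first by rewrite !big_ord0.
rewrite big_ord_recr /= -IH -!(big_mkord xpredT) mulSn addnC.
rewrite (big_cat_nat (n := m * k))//= ?leq_addr//; congr (_ + _).
rewrite -[in LHS](addnC k) -{1}[(m * k)%N]add0n big_addn addnK.
by rewrite !big_mkord; apply: eq_bigr => i _; rewrite addnC.
Qed.

Definition digit (N s t : nat) : nat := (s %/ N ^ t) %% N.

Section Seeds.
Variables (R : realType) (N : nat).
Hypothesis N_gt0 : (0 < N)%N.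

(** Expectation over [t] independent base-[N] coins. [F] lives on all of [nat], so one function can
    be averaged over different numbers of coins. *)
Definition seed_mean (t : nat) (F : nat -> R) : R :=
  (N ^ t)%:R^-1 * \sum_(s < N ^ t) F s.

Lemma seed_mean_le t (F G : nat -> R) :
  (forall s, F s <= G s) -> seed_mean t F <= seed_mean t G.
Proof.
by move=> FG; rewrite ler_wpM2l ?invr_ge0 ?ler0n// ler_sum.
Qed.

Lemma seed_meanZ t a (F : nat -> R) :
  seed_mean t (fun s => a * F s) = a * seed_mean t F.
Proof. by rewrite /seed_mean -mulr_sumr mulrCA. Qed.

Lemma seed_meanD t (F G : nat -> R) :
  seed_mean t (fun s => F s + G s) = seed_mean t F + seed_mean t G.
Proof. by rewrite /seed_mean big_split mulrDr. Qed.

Lemma seed_mean_sum t (I : finType) (F : I -> nat -> R) :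
  seed_mean t (fun s => \sum_i F i s) = \sum_i seed_mean t (F i).
Proof. by rewrite /seed_mean exchange_big mulr_sumr. Qed.

(** Splits off the top digit [a], the coin of step [t]; the inner average is the conditional
    expectation given the earlier coins, which are stored in [b]. *)
Lemma seed_meanS t (F : nat -> R) :
  seed_mean t.+1 F =
  seed_mean t (fun b => N%:R^-1 * \sum_(a < N) F (a * N ^ t + b)%N).
Proof.
rewrite /seed_mean -mulr_sumr mulrA -invfM -natrM expnSr; congr (_ * _).
by rewrite mulnC sum_ord_mul exchange_big.
Qed.

Lemma digit_high t a b : (a < N)%N -> (b < N ^ t)%N ->
  digit N (a * N ^ t + b) t = a.
Proof.
move=> aN bN; rewrite /digit divnMDl ?expn_gt0 ?N_gt0//.
by rewrite divn_small// addn0 modn_small.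
Qed.

Lemma digit_low t tau a b : (tau < t)%N ->
  digit N (a * N ^ t + b) tau = digit N b tau.
Proof.
move=> lt; rewrite /digit.
have -> : (N ^ t = N ^ (t - tau.+1) * N * N ^ tau)%N.
  by rewrite -mulnA -expnS -expnD subnK.
by rewrite mulnA divnMDl ?expn_gt0 ?N_gt0// mulnA modnMDl.
Qed.

Lemma seed_meanS_low t (F : nat -> R) :
  (forall a b, F (a * N ^ t + b)%N = F b) -> seed_mean t.+1 F = seed_mean t F.
Proof.
move=> FE; rewrite seed_meanS; congr (_ * _); apply: eq_bigr => b _.
under eq_bigr do rewrite FE.
rewrite sumr_const card_ord -[F b *+ N]mulr_natl mulrA mulVf ?mul1r//.
by rewrite pnatr_eq0 -lt0n.
Qed.

(** Coins tossed after time [t] average out of a quantity that ignores them; this moves bounds at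
    time [t] to the full horizon. *)
Lemma seed_mean_low t T (F : nat -> R) : (t <= T)%N ->
  (forall r a b, (t <= r)%N -> F (a * N ^ r + b)%N = F b) ->
  seed_mean T F = seed_mean t F.
Proof.
move=> tT FE; rewrite -(subnK tT); elim: (T - t)%N => // k IH.
by rewrite addSn seed_meanS_low// => a b; rewrite FE// leq_addl.
Qed.

End Seeds.

(** * A biased coin from a uniform digit *)

Lemma sum_ltr_nat (R : realType) (N : nat) (theta : R) : 0 <= theta ->
  (theta <= N%:R ->
     theta <= \sum_(a < N) ((a%:R < theta)%R%:R : R) <= theta + 1) /\
  (N%:R <= theta -> \sum_(a < N) ((a%:R < theta)%R%:R : R) = N%:R :> R).
Proof.
(* The sum is the ceiling of [theta] capped at [N]; the induction passes through ranges shorter than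
   [theta], whence the second clause. *)
move=> t0; elim: N => [|N [IH1 IH2]].
  by rewrite big_ord0; split => // tle; apply/andP; split; lra.
rewrite big_ord_recr /=; case: (ltP N%:R theta) => [Nt|tN].
  rewrite IH2 ?(ltW Nt)// natr1; split => // tle.
  by rewrite tle -natr1 lerD2r ltW.
rewrite addr0; split => [_|]; first exact: IH1.
by rewrite -natr1 => h; move: (le_trans h tN); lra.
Qed.

(** The sign has mean [- z] up to rounding, so averaging [1 + x + 2 * x ^+ 2] at [x = y] and
    [x = - y] gives the exponent to first order; [1 + x <= expR x] then restores the exponential. *)
Lemma coin_mgf (R : realType) (N : nat) (z y : R) : (0 < N)%N ->
  `|z| <= 1 -> `|y| <= 2^-1 ->
  N%:R^-1 * \sum_(a < N)
     expR (sign_of R (a%:R < N%:R * ((1 - z) / 2)) * y)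
  <= expR (- (z * y) + 2 * y ^+ 2 + N%:R^-1).
Proof.
move=> N0 z1 y2; set theta := N%:R * _.
have N0' : 0 < N%:R :> R by rewrite ltr0n.
have /andP[z1a z1b] : -1 <= z <= 1 by rewrite -ler_norml.
have /andP[y2a y2b] : - 2^-1 <= y <= 2^-1 by rewrite -ler_norml.
have th0 : 0 <= theta by rewrite mulr_ge0 ?ler0n//; lra.
have thN : theta <= N%:R by rewrite ler_piMr ?ler0n//; lra.
have [/(_ thN) /andP[K1 K2] _] := sum_ltr_nat N th0.
set K := \sum_(a < N) _ in K1 K2.
have bound a : expR (sign_of R (a%:R < theta) * y) <=
    (1 + 2 * y ^+ 2 - y) + 2 * y * (a%:R < theta)%R%:R.
  rewrite /sign_of; case: (_ < theta); rewrite ?mul1r ?mulN1r ?mulr1 ?mulr0.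
    by apply: le_trans (expR_le_quadratic _) _; lra.
  by apply: le_trans (expR_le_quadratic _) _; rewrite ?sqrrN; lra.
apply: (@le_trans _ _ (1 + (- (z * y) + 2 * y ^+ 2 + N%:R^-1))); last first.
  exact: expR_ge1Dx.
rewrite mulrC ler_pdivrMr//.
apply: (@le_trans _ _ (\sum_(a < N)
    (1 + 2 * y ^+ 2 - y + 2 * y * (a%:R < theta)%R%:R))).
  by apply: ler_sum => a _; exact: bound.
rewrite big_split /= -mulr_sumr sumr_const card_ord -/K.
rewrite -[X in X + _]mulr_natl mulrDl !mulrDl mulVf ?gt_eqF//.
have e : theta * 2 = N%:R - N%:R * z by rewrite /theta; field.
(* Rounding enters as [2 * y * (K - theta) / N]; as [K - theta] lies in [0, 1], it costs at most
   [1 / N]. *)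
have : y * (K - theta) <= 2^-1 by nra.
by move: e; nra.
Qed.

(** * The self-balancing walk on a fixed sequence *)

Section Walk.
Variables (R : realType) (n N : nat) (c : R) (x : nat -> 'I_n -> R).
Hypothesis N_gt0 : (0 < N)%N.

Definition dot (u w : 'I_n -> R) : R := \sum_i u i * w i.

Fixpoint walk (s t : nat) : 'I_n -> R :=
  if t is t'.+1 then
    let w := walk s t' in
    fun i => w i + sign_of R ((digit N s t')%:R <
                      N%:R * ((1 - dot w (x t') / c) / 2)) * x t' i
  else fun=> 0.

Definition walk_choice (s t : nat) : bool :=
  (digit N s t)%:R < N%:R * ((1 - dot (walk s t) (x t) / c) / 2).

(** Survival of all tests strictly before time [t]. While it holds, the biases used so far are
    genuine probabilities; multiplying by its indicator replaces conditioning. *)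
Fixpoint alive (s t : nat) : bool :=
  if t is t'.+1 then alive s t' && (`|dot (walk s t') (x t')| <= c) else true.

Lemma walkS s t i :
  walk s t.+1 i = walk s t i + sign_of R (walk_choice s t) * x t i.
Proof. by []. Qed.

Lemma walkE s t i :
  walk s t i = \sum_(tau < t) sign_of R (walk_choice s tau) * x tau i.
Proof. by elim: t => [|t IH]; rewrite ?big_ord0// big_ord_recr -IH. Qed.

Lemma walk_low t r a b : (t <= r)%N -> walk (a * N ^ r + b) t = walk b t.
Proof.
elim: t => // t IH tr; apply/funext => i; rewrite !walkS /walk_choice.
by rewrite IH ?(ltnW tr)// digit_low.
Qed.

Lemma alive_low t r a b : (t <= r)%N -> alive (a * N ^ r + b) t = alive b t.
Proof.
by elim: t => //= t IH tr; rewrite IH ?(ltnW tr)// walk_low// ltnW.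
Qed.

Hypothesis c_ge1 : 1 <= c.
Hypothesis x_le1 : forall t, dot (x t) (x t) <= 1.

Lemma dotZl a (u w : 'I_n -> R) : dot (fun i => a * u i) w = a * dot u w.
Proof. by rewrite /dot mulr_sumr; apply: eq_bigr => i _; rewrite mulrA. Qed.

Lemma dotC (u w : 'I_n -> R) : dot u w = dot w u.
Proof. by apply: eq_bigr => i _; rewrite mulrC. Qed.

Lemma dotDl (u v w : 'I_n -> R) :
  dot (fun i => u i + v i) w = dot u w + dot v w.
Proof.
by rewrite /dot -big_split; apply: eq_bigr => i _; rewrite mulrDl.
Qed.

(** Expand the squared norms of [u + v / 2] and [u - v / 2], which are nonnegative. *)
Lemma dot_le_half (u v : 'I_n -> R) :
  dot u u <= 4^-1 -> dot v v <= 1 -> `|dot u v| <= 2^-1.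
Proof.
move=> u4 v1; rewrite ler_norml; apply/andP; split.
  have : - dot u v <= dot u u + 4^-1 * dot v v.
    rewrite /dot mulr_sumr -big_split -sumrN; apply: ler_sum => i _ /=.
    by have := sqr_ge0 (u i + 2^-1 * v i); nra.
  lra.
have : dot u v <= dot u u + 4^-1 * dot v v.
  rewrite /dot mulr_sumr -big_split; apply: ler_sum => i _ /=.
  by have := sqr_ge0 (u i - 2^-1 * v i); nra.
lra.
Qed.

Lemma dot_walkS (u : 'I_n -> R) s t :
  dot u (walk s t.+1) =
  dot u (walk s t) + sign_of R (walk_choice s t) * dot u (x t).
Proof.
rewrite dotC (_ : walk s t.+1 =
  fun i => walk s t i + sign_of R (walk_choice s t) * x t i)//.
by rewrite dotDl dotZl (dotC u) (dotC u).
Qed.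

Lemma walk_mgf t (u : 'I_n -> R) : dot u u <= 4^-1 ->
  seed_mean N t (fun s => (alive s t)%:R * expR (dot u (walk s t)))
  <= expR (2 * c * dot u u + t%:R / N%:R).
Proof.
have c1 := c_ge1; elim: t u => [|t IH] u u4.
  rewrite /seed_mean expn0 invr1 mul1r big_ord1 /= mul1r mul0r addr0 ler_expR.
  have -> : dot u (fun=> 0) = 0 by rewrite /dot big1// => i _; rewrite mulr0.
  apply: mulr_ge0; first by rewrite mulr_ge0//; lra.
  by apply: sumr_ge0 => i _; rewrite -expr2 sqr_ge0.
have c0 : 0 < c by lra.
set y := dot u (x t).
(* The drift of the coin contributes [- y / c * <w, x t>], which is absorbed into the test vector;
   hence the induction is over all [u] at once. *)
pose u' i := u i + (- (y / c)) * x t i.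
have u'w w : dot u' w = dot u w - y / c * dot w (x t).
  by rewrite dotDl dotZl (dotC w) mulNr.
(* The cross term loses [2 * y ^+ 2 / c], and the quadratic term returns at most half of it because
   [|x t|^2 <= 1 <= c]. *)
have u'u' : dot u' u' <= dot u u - y ^+ 2 / c.
  rewrite u'w (dotC u) !u'w -/y.
  have := x_le1 t; set q := dot (x t) (x t) => q1.
  have -> : y ^+ 2 / c = y * (y / c) by field; lra.
  set r := y / c.
  have -> : y = r * c by rewrite /r divfK// gt_eqF.
  have : r ^+ 2 * q <= r ^+ 2 * c.
    by rewrite ler_wpM2l ?sqr_ge0//; lra.
  nra.
have y2 : `|y| <= 2^-1 by apply: dot_le_half.
rewrite seed_meanS//.
apply: (@le_trans _ _ (seed_mean N t (fun s =>
    expR (2 * y ^+ 2 + N%:R^-1) * ((alive s t)%:R * expR (dot u' (walk s t)))))).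
  rewrite /seed_mean ler_wpM2l ?invr_ge0 ?ler0n//; apply: ler_sum => b _.
  have step (a : 'I_N) : (alive (a * N ^ t + b) t.+1)%:R *
      expR (dot u (walk (a * N ^ t + b) t.+1)) =
      (alive b t && (`|dot (walk b t) (x t)| <= c))%R%:R *
      expR (dot u (walk b t)) *
      expR (sign_of R (a%:R < N%:R * ((1 - dot (walk b t) (x t) / c) / 2)) * y).
    rewrite [alive _ _]/= alive_low// walk_low//.
    rewrite -mulrA -expRD; congr (_ * expR _).
    by rewrite dot_walkS /walk_choice walk_low// digit_high.
  under eq_bigr do rewrite step.
  rewrite -mulr_sumr; case: (alive b t) => /=; last by rewrite !(mul0r, mulr0).
  case: (boolP (_ <= c)) => [wc|_]; last first.
    by rewrite !(mul0r, mulr0) !mulr_ge0 ?expR_ge0.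
  rewrite !mul1r mulrCA.
  have z1 : `|dot (walk b t) (x t) / c| <= 1.
    by rewrite normrM normfV (gtr0_norm c0) ler_pdivrMr// mul1r.
  apply: le_trans (ler_wpM2l (expR_ge0 _) (coin_mgf N_gt0 z1 y2)) _.
  rewrite -!expRD ler_expR u'w.
  rewrite [leLHS](_ : _ = 2 * y ^+ 2 + N%:R^-1 +
     (dot u (walk b t) - y / c * dot (walk b t) (x t)))//; ring.
rewrite seed_meanZ.
have u'4 : dot u' u' <= 4^-1.
  have : 0 <= y ^+ 2 / c by rewrite divr_ge0 ?sqr_ge0 ?ltW.
  lra.
apply: le_trans (ler_wpM2l (expR_ge0 _) (IH _ u'4)) _.
rewrite -expRD ler_expR -natr1 mulrDl mul1r.
have : 2 * c * dot u' u' <= 2 * c * (dot u u - y ^+ 2 / c).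
  by rewrite ler_wpM2l//; lra.
(* The factor [2 * c] is chosen so that this loss cancels the variance term [2 * y ^+ 2] of the coin
   exactly. *)
have -> : 2 * c * (dot u u - y ^+ 2 / c) = 2 * c * dot u u - 2 * y ^+ 2.
  by field; lra.
lra.
Qed.

(** Chernoff with [u = v / 4] and [u = - v / 4]: the moment is at most [expR (1 + c / 8)], while the
    event makes one of the two exponentials exceed [expR (c / 4)]. *)
Lemma walk_tail t (v : 'I_n -> R) : (t <= N)%N -> dot v v <= 1 ->
  seed_mean N t (fun s => (alive s t && (c < `|dot v (walk s t)|))%R%:R)
  <= 2 * expR (1 - c / 8).
Proof.
move=> tN v1.
have tail_le (e : R) : e ^+ 2 = 1 ->
    seed_mean N t (fun s => (alive s t)%:R *
      expR (dot (fun i => e / 4 * v i) (walk s t)))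
    <= expR (1 + c / 8).
  move=> e1.
  have vv : dot (fun i => e / 4 * v i) (fun i => e / 4 * v i) = dot v v / 16.
    rewrite dotZl dotC dotZl mulrA (_ : e / 4 * (e / 4) = e ^+ 2 / 16).
      by rewrite e1; field.
    by field.
  apply: le_trans (walk_mgf _ _) _; first by rewrite vv; lra.
  rewrite ler_expR vv addrC lerD//.
    by rewrite ler_pdivrMr ?ltr0n// mul1r ler_nat.
  have c1 := c_ge1.
  rewrite [leRHS](_ : _ = 2 * c * (1 / 16)); last by field.
  by rewrite ler_wpM2l//; lra.
apply: (@le_trans _ _ (seed_mean N t (fun s => expR (- (c / 4)) *
   ((alive s t)%:R * expR (dot (fun i => 1 / 4 * v i) (walk s t)) +
    (alive s t)%:R * expR (dot (fun i => -1 / 4 * v i) (walk s t)))))).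
  apply: seed_mean_le => s; case: (alive s t) => /=;
    last by rewrite !mul0r addr0 mulr0.
  rewrite !mul1r !dotZl mulrDr -!expRD.
  case: (ltP c) => [|_]; last by rewrite addr_ge0// expR_ge0.
  rewrite lter_normr => /orP[cv|cv].
    rewrite -[leLHS]addr0 lerD ?expR_ge0// -[leLHS]expR0 ler_expR; lra.
  rewrite -[leLHS]add0r lerD ?expR_ge0// -[leLHS]expR0 ler_expR; lra.
rewrite seed_meanZ seed_meanD.
apply: (@le_trans _ _ (expR (- (c / 4)) * (expR (1 + c / 8) + expR (1 + c / 8)))).
  by rewrite ler_wpM2l ?expR_ge0// lerD// tail_le//; ring.
rewrite mulrDr -expRD (_ : - (c / 4) + (1 + c / 8) = 1 - c / 8); last by field.
lra.
Qed.

(** At the earliest violated test the walk is still alive, so [walk_tail] applies there. *)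
Lemma first_failure s t : ~~ alive s t ->
  exists2 tau, (tau < t)%N & alive s tau && (c < `|dot (x tau) (walk s tau)|).
Proof.
elim: t => //= t IH; rewrite negb_and; case: (boolP (alive s t)) => [al|nal].
  by rewrite -ltNge dotC => h; exists t => //; rewrite al.
by move=> _; have [tau tt h] := IH nal; exists tau => //; rewrite ltnS ltnW.
Qed.

Lemma walk_bounded T : (T <= N)%N ->
  seed_mean N T (fun s =>
    (~~ [forall t : 'I_T, forall i, `|walk s t.+1 i| <= c])%R%:R)
  <= (T * n.+1)%:R * (2 * expR (1 - c / 8)).
Proof.
move=> TN.
(* Union bound over [T * n.+1] events: [None] tests the incoming vector before the step, [Some i]
   tests coordinate [i] after it. *)
pose time (k : 'I_T * option 'I_n) : nat := if k.2 is None then k.1 else k.1.+1.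
pose test (k : 'I_T * option 'I_n) : 'I_n -> R :=
  if k.2 is Some i then fun j => (j == i)%:R else x k.1.
pose fails k s := alive s (time k) && (c < `|dot (test k) (walk s (time k))|).
have dot_delta i w : dot (fun j => (j == i)%:R) w = w i.
  rewrite /dot (bigD1 i)//= eqxx mul1r big1 ?addr0// => j /negbTE ->.
  by rewrite mul0r.
have union s : (~~ [forall t : 'I_T, forall i, `|walk s t.+1 i| <= c])%R%:R
    <= \sum_k (fails k s)%:R :> R.
  have suff_fail k : fails k s -> 1 <= \sum_k (fails k s)%:R :> R.
    by move=> fk; rewrite (bigD1 k)//= fk lerDl sumr_ge0.
  case: (boolP [forall t, _]) => [_|]; first exact: sumr_ge0.
  rewrite negb_forall => /existsP[t]; rewrite negb_forall => /existsP[i].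
  rewrite -ltNge => wc; case: (boolP (alive s t.+1)) => [al|].
    apply: (suff_fail (t, Some i)).
    by rewrite /fails /time /test/= -/(alive s t.+1) al dot_delta.
  move=> /first_failure[tau taut h].
  have tauT : (tau < T)%N by apply: leq_trans taut _; apply: ltn_ord.
  exact: (suff_fail (Ordinal tauT, None)).
apply: le_trans (seed_mean_le _ _ union) _; rewrite seed_mean_sum.
rewrite [leRHS](_ : _ = \sum_(k : 'I_T * option 'I_n) (2 * expR (1 - c / 8))).
  apply: ler_sum => k _.
  have kT : (time k <= T)%N.
    by case: k => t [i|]; rewrite /time/= ?(ltnW (ltn_ord t)).
  rewrite (seed_mean_low N_gt0 kT).
    apply: walk_tail; first exact: leq_trans kT TN.
    by case: k {kT} => t [i|]; rewrite /test/= ?dot_delta ?eqxx.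
  by move=> r a b kr; rewrite /fails alive_low// walk_low.
by rewrite sumr_const card_prod card_option !card_ord -[RHS]mulr_natl.
Qed.

End Walk.

(** * Measurability of the online choices *)

Lemma tnth_rcons_widen (X : Type) t (p : t.-tuple X) r (i : 'I_t) :
  tnth [tuple of rcons p r] (widen_ord (leqnSn t) i) = tnth p i.
Proof. by rewrite !(tnth_nth r) /= nth_rcons size_tuple ltn_ord. Qed.

Lemma tnth_rcons_last (X : Type) t (p : t.-tuple X) r :
  tnth [tuple of rcons p r] ord_max = r.
Proof. by rewrite (tnth_nth r) /= nth_rcons size_tuple ltnn eqxx. Qed.

(** Case analysis matching the [rcons] in [choices]: the newest index, or one of the past. *)
Variant ord_last_spec t : 'I_t.+1 -> Type :=
  | OrdLast : ord_last_spec ord_max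
  | OrdWiden (j : 'I_t) : ord_last_spec (widen_ord (leqnSn t) j).

Lemma ord_lastP t (i : 'I_t.+1) : ord_last_spec i.
Proof.
case: (unliftP ord_max i) => [j ->|->]; last exact: OrdLast.
rewrite (_ : lift ord_max j = widen_ord (leqnSn t) j); first exact: OrdWiden.
by apply/val_inj; rewrite /= /bump leqNgt ltn_ord.
Qed.

Section MeasurableChoices.
Variables (R : realType) (n : nat).

Lemma measurable_tuple_comp d (X : measurableType d) d' (Y : measurableType d')
    m (f : X -> m.-tuple Y) (i : 'I_m) :
  measurable_fun setT f -> measurable_fun setT (fun z => tnth (f z) i).
Proof. by move=> /measurable_fun_tnthP /(_ i). Qed.

Lemma measurable_sign d (X : measurableType d) (f : X -> bool) :
  measurable_fun setT f -> measurable_fun setT (fun z => sign_of R (f z)).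
Proof. by move=> mf; apply: (measurableT_comp (f := sign_of R)). Qed.

Lemma measurable_choices (A : online_alg R n) t :
  measurable_fun setT
    (fun z : seed A * t.-tuple (n.-tuple R) => choices z.1 z.2).
Proof.
elim: t => [|t IH]; apply/measurable_fun_tnthP; first by case.
have mpre : measurable_fun setT
    (fun z : seed A * t.+1.-tuple (n.-tuple R) => choices z.1 (tuple_prefix z.2)).
  apply: (measurableT_comp IH (g := fun z => (z.1, tuple_prefix z.2))).
  apply: measurable_fun_pair => //=; apply/measurable_fun_tnthP => i /=.
  rewrite (_ : _ \o _ = fun z : seed A * t.+1.-tuple (n.-tuple R) =>
    tnth z.2 (widen_ord (leqnSn t) i)); last first.
    by apply/funext => z /=; rewrite tnth_mktuple.
  exact: measurable_tuple_comp.
move=> i; case: (ord_lastP i) => [|j].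
  rewrite (_ : _ \o _ = fun z => rule (z.1, z.2, choices z.1 (tuple_prefix z.2)));
    last by apply/funext => z; rewrite /comp /= tnth_rcons_last.
  apply: (measurableT_comp (measurable_rule (o := A) (t := t))
    (g := fun z => (z.1, z.2, choices z.1 (tuple_prefix z.2)))).
  by do !apply: measurable_fun_pair => //.
rewrite (_ : _ \o _ = fun z => tnth (choices z.1 (tuple_prefix z.2)) j);
  last by apply/funext => z; rewrite /comp /= tnth_rcons_widen.
exact: measurable_tuple_comp.
Qed.

End MeasurableChoices.

(** * The walk as an online algorithm *)

Section BalancingAlgorithm.
Variables (R : realType) (n N : nat) (c : R) (M : nat).

(** The position of the walk is recomputed from the revealed vectors and the earlier signs; of the
    seed, only digit [t] is read. *)
Definition balancing_rule (t : nat)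
    (z : nat * t.+1.-tuple (n.-tuple R) * t.-tuple bool) : bool :=
  (digit N z.1.1 t)%:R < N%:R * ((1 -
    (\sum_i (\sum_(tau < t) sign_of R (tnth z.2 tau) *
              tnth (tnth z.1.2 (widen_ord (leqnSn t) tau)) i) *
            tnth (tnth z.1.2 ord_max) i) / c) / 2).

Lemma measurable_balancing_rule t : measurable_fun setT (@balancing_rule t).
Proof.
have m11 : measurable_fun setT
    (fun z : nat * t.+1.-tuple (n.-tuple R) * t.-tuple bool => z.1.1).
  exact: measurableT_comp.
have m12 : measurable_fun setT
    (fun z : nat * t.+1.-tuple (n.-tuple R) * t.-tuple bool => z.1.2).
  exact: measurableT_comp.
apply: measurable_fun_ltr.
  by apply: (measurableT_comp (f := fun s => (digit N s t)%:R : R)).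
apply: measurable_funM => //; apply: measurable_funM => //.
apply: measurable_funB => //; apply: measurable_funM => //.
apply: measurable_sum => i; apply: measurable_funM.
  apply: measurable_sum => tau; apply: measurable_funM.
    by apply/measurable_sign/measurable_tuple_comp.
  by do !apply: measurable_tuple_comp.
by do !apply: measurable_tuple_comp.
Qed.

(* [\d_0] is the value of [mnormalize] when [M = 0], and plays no role. *)
Definition uniform_seed : probability nat R :=
  mnormalize (msum (fun k : nat => \d_k) M) \d_0%N.

Definition balancing_alg : online_alg R n :=
  OnlineAlg uniform_seed measurable_balancing_rule.

Lemma uniform_seedE (A : set nat) : (0 < M)%N ->
  uniform_seed A = (M%:R^-1 * \sum_(k < M) (val k \in A)%:R)%:E.
Proof.
move=> M0.
have mE (B : set nat) :
    msum (fun k : nat => \d_k) M B = (\sum_(k < M) (val k \in B)%:R : R)%:E.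
  by rewrite /msum -sumEFin; apply: eq_bigr => k _; rewrite /= diracE.
have mT : msum (fun k : nat => \d_k) M [set: nat] = (M%:R : R)%:E.
  rewrite mE; congr (_%:E); under eq_bigr do rewrite in_setT.
  by rewrite sumr_const card_ord.
rewrite /uniform_seed /= /mnormalize /= mT eqe.
rewrite pnatr_eq0 -[M == 0%N]negbK -lt0n M0 /=.
by rewrite mE -EFinM mulrC.
Qed.

(** The sequence [x] extends the tuple [v], and hence each of its prefixes, so the same [x] serves
    throughout the induction. *)
Lemma balancing_choicesE (x : nat -> 'I_n -> R) s t (v : t.-tuple (n.-tuple R)) :
  (forall (j : 'I_t) i, x j i = tnth (tnth v j) i) ->
  forall j : 'I_t,
    tnth (choices (A := balancing_alg) s v) j = walk_choice N c x s j.
Proof.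
elim: t v => [|t IH] v xv j; first by case: j.
have {}IH : forall j : 'I_t,
    tnth (choices (A := balancing_alg) s (tuple_prefix v)) j =
    walk_choice N c x s j.
  by apply: IH => k i; rewrite tnth_mktuple -xv.
case: (ord_lastP j) => [|k]; rewrite [choices _ _]/=.
  rewrite tnth_rcons_last /walk_choice /balancing_rule /=.
  congr (_ < _ * ((1 - _ / _) / _)); apply: eq_bigr => i _.
  rewrite walkE -xv /=; congr (_ * _); apply: eq_bigr => tau _.
  by rewrite IH -xv.
by rewrite tnth_rcons_widen IH.
Qed.

Lemma balancing_discrepancyE (x : nat -> 'I_n -> R) s T
    (v : T.-tuple (n.-tuple R)) :
  (forall (j : 'I_T) i, x j i = tnth (tnth v j) i) ->
  forall (t : 'I_T) i,
    tnth (discrepancy (choices (A := balancing_alg) s v) v t) i =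
    walk N c x s t.+1 i.
Proof.
move=> xv t i; rewrite tnth_mktuple walkE.
rewrite (big_ord_widen T
  (fun tau => sign_of R (walk_choice N c x s tau) * x tau i))//.
by apply: eq_bigr => tau _; rewrite xv (balancing_choicesE s xv).
Qed.

End BalancingAlgorithm.

(** * Numerical constants and success on fixed inputs *)

Lemma linfnorm_leP (R : realType) n (v : n.-tuple R) (b : R) : 0 <= b ->
  linfnorm v <= b <-> forall i, `|tnth v i| <= b.
Proof.
move=> b0; split=> [vb i|vb]; first by apply: le_trans vb; exact: le_bigmax.
exact: bigmax_le.
Qed.

Lemma expR_half_le2 (R : realType) : expR 2^-1 <= 2 :> R.
Proof.
by apply: le_trans (expR_le_quadratic _) _; rewrite // expr2; lra.
Qed.

Lemma half_le_ln (R : realType) (m : R) : 2 <= m -> 2^-1 <= ln m.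
Proof.
move=> m2; have m0 : 0 < m by lra.
rewrite -ler_expR lnK ?posrE//.
exact: le_trans (expR_half_le2 R) m2.
Qed.

(** Explains the [5] in the threshold: one power of [m] pays for the number of events, four pay for
    the constant, as [4 * e <= 16 <= m ^+ 4]. *)
Lemma failure_le (R : realType) (m : R) (k : nat) : 2 <= m ->
  2 * m * (2 * expR (1 - 8 * (k + 5)%:R * ln m / 8)) <= m ^- k.
Proof.
move=> m2; have m0 : 0 < m by lra.
have -> : 1 - 8 * (k + 5)%:R * ln m / 8 =
    2^-1 + 2^-1 - (k + 5)%:R * ln m by field.
rewrite !expRD expRN expRM_natl lnK ?posrE// exprD exprS.
have e2 := expR_half_le2 R; have e0 := expR_ge0 (2^-1 : R).
have m4 : 16 <= m ^+ 4.
  have -> : 16 = 2 ^+ 4 :> R by ring.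
  by rewrite lerXn2r// nnegrE; lra.
have mk : 0 < m ^+ k by rewrite exprn_gt0.
rewrite [leLHS](_ : _ = 4 * (expR 2^-1 * expR 2^-1) / m ^+ 4 / m ^+ k);
  last by field; rewrite !gt_eqF.
apply: ler_piMl; first by rewrite invr_ge0 ltW.
rewrite ler_pdivrMr; last by lra.
by rewrite mul1r; apply: le_trans m4; nra.
Qed.

Section Success.
Variables (R : realType) (k n T : nat).
Hypothesis n_gt0 : (0 < n)%N.
Hypothesis T_gt0 : (0 < T)%N.

Let c : R := 8 * (k + 5)%:R * ln (n * T)%:R.
Let A := balancing_alg n T c (T ^ T).

Lemma balancing_success (v : T.-tuple (n.-tuple R)) : (2 <= n * T)%N ->
  (forall t, l2norm (tnth v t) <= 1) ->
  ((1 - (n * T)%:R ^- k)%:E <=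
   seed_law A [set s | forall (t : 'I_T) i,
     (`|tnth (discrepancy (choices (A := A) s v) v t) i| <= c)%R])%E.
Proof.
move=> m2 v1.
(* Padding by zero vectors keeps all norms at most 1. *)
pose x (t : nat) i := if insub t is Some j then tnth (tnth v j) i else 0.
have xv (j : 'I_T) i : x j i = tnth (tnth v j) i by rewrite /x valK.
have x1 t : dot (x t) (x t) <= 1.
  rewrite /dot /x; case: insubP => [j _ _|_]; last first.
    by rewrite big1 ?ler01// => i _; rewrite mul0r.
  by have := v1 j; rewrite -[leRHS](sqrtr1 R) ler_sqrt.
have m2' : 2 <= (n * T)%:R :> R by rewrite (ler_nat _ 2).
have c1 : 1 <= c.
  rewrite /c; have l2 := half_le_ln m2'.
  have k5 : 5 <= (k + 5)%:R :> R by rewrite (ler_nat _ 5) leq_addl.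
  nra.
have TT : (0 < T ^ T)%N by rewrite expn_gt0 T_gt0.
rewrite uniform_seedE// lee_fin lerBlDl.
(* Every seed either breaks the bound for the walk or lies in the success set. *)
apply: (@le_trans _ _ ((T ^ T)%:R^-1 * (\sum_(s < T ^ T)
   ((~~ [forall t : 'I_T, forall i, `|walk T c x s t.+1 i| <= c])%R%:R +
   (val s \in [set s | forall (t : 'I_T) i,
     `|tnth (discrepancy (choices (A := A) s v) v t) i| <= c])%R%:R)))).
  rewrite -[leLHS](@mulVf _ (T ^ T)%:R) ?pnatr_eq0 -?lt0n//.
  rewrite ler_wpM2l ?invr_ge0 ?ler0n//.
  rewrite -[X in X%:R <= _](card_ord (T ^ T)) -sum1_card natr_sum.
  apply: ler_sum => s _.
  case: (boolP [forall t, _]) => [/forallP good|_] /=; last by rewrite lerDl.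
  rewrite add0r mem_set// => t i; rewrite (balancing_discrepancyE s xv).
  exact: (forallP (good t)).
rewrite big_split mulrDr lerD2r.
apply: le_trans (walk_bounded T_gt0 c1 x1 (leqnn T)) _.
apply: le_trans (failure_le k m2'); apply: ler_wpM2r.
  by rewrite mulr_ge0// expR_ge0.
(* The number of events satisfies [T * n.+1 <= 2 * (n * T)] since [n >= 1]. *)
rewrite -natrM ler_nat mulnA [leqRHS]mulnC leq_mul//.
by rewrite mul2n -addnn -addn1 leq_add2l.
Qed.

End Success.

(** * Random inputs: measurability and Fubini *)

Lemma measurable_discrepancy_le (R : realType) n T (A : online_alg R n)
    d (Omega : measurableType d) (V : 'I_T -> Omega -> n.-tuple R) (b : R) :
  (forall t, measurable_fun setT (V t)) ->
  measurable [set ws : Omega * seed A |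
    let v := [tuple V t ws.1 | t < T] in
    forall t i, `|tnth (discrepancy (choices ws.2 v) v t) i| <= b].
Proof.
move=> mV.
have mv : measurable_fun setT
    (fun ws : Omega * seed A => [tuple V t ws.1 | t < T]).
  apply/measurable_fun_tnthP => t /=.
  rewrite (_ : _ \o _ = V t \o fst); first exact: measurableT_comp.
  by apply/funext => ws /=; rewrite tnth_mktuple.
have mchi : measurable_fun setT (fun ws : Omega * seed A =>
    choices ws.2 [tuple V t ws.1 | t < T]).
  apply: (measurableT_comp (measurable_choices (A := A) (t := T))
    (g := fun ws => (ws.2, [tuple V t ws.1 | t < T]))).
  exact: measurable_fun_pair.
rewrite (_ : mkset _ = \bigcap_(ti in [set: 'I_T * 'I_n])
    [set ws : Omega * seed A | let v := [tuple V t ws.1 | t < T] in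
      `|tnth (discrepancy (choices ws.2 v) v ti.1) ti.2| <= b]); last first.
  by apply/seteqP; split => ws /= h; [move=> [t i] _ /=; exact: h
    | move=> t i; exact: (h (t, i))].
apply: fin_bigcap_measurable => [|[t i] _ /=]; first exact: finite_finset.
rewrite -[X in measurable X]setTI.
(* The range condition becomes an [if], so that [measurable_sum] applies. *)
pose f (ws : Omega * seed A) : R := `|\sum_(tau < T) (if (tau <= t)%N then
   sign_of R (tnth (choices ws.2 [tuple V t ws.1 | t < T]) tau) *
   tnth (tnth [tuple V t ws.1 | t < T] tau) i else 0)|.
rewrite (_ : mkset _ = (fun ws : Omega * seed A => f ws <= b) @^-1` [set true]).
  have mf : measurable_fun setT (fun ws : Omega * seed A => f ws <= b).
    apply: measurable_fun_ler => //; apply: measurableT_comp => //.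
    apply: measurable_sum => tau; case: (tau <= t)%N => //.
    apply: measurable_funM; first exact/measurable_sign/measurable_tuple_comp.
    by do 2!apply: measurable_tuple_comp.
  exact: mf.
have fE ws : f ws = `|tnth (discrepancy (choices ws.2 [tuple V t ws.1 | t < T])
    [tuple V t ws.1 | t < T] t) i|.
  by rewrite /f [in RHS]tnth_mktuple [in RHS]big_mkcond.
by apply/seteqP; split => ws /=; rewrite fE.
Qed.

Lemma measurable_l2ball (R : realType) n (r : R) :
  measurable [set v : n.-tuple R | l2norm v <= r].
Proof.
have ml2 : measurable_fun setT (fun v : n.-tuple R => l2norm v).
  apply: (measurableT_comp (f := @Num.sqrt R)).
    by apply: continuous_measurable_fun; exact: sqrt_continuous.
  apply: measurable_sum => i; apply: measurable_funX.
  exact: measurable_tnth.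
rewrite -[X in measurable X]setTI.
exact: (measurable_fun_ler ml2 (measurable_cst r) measurableT (Y := [set true])).
Qed.

Theorem theorem1p1 (R : realType) (c : nat) :
  exists2 C : R, 0 < C &
  forall (n T : nat) (p : probability (n.-tuple R) R),
    (0 < n)%N -> (0 < T)%N ->
    p [set v : n.-tuple R | l2norm v <= 1] = 1%E ->
  exists A : online_alg R n,
  forall (d : measure_display) (Omega : measurableType d)
    (P : probability Omega R) (V : 'I_T -> {RV P >-> n.-tuple R}),
    iid p V ->
    ((1 - (n * T)%:R ^- c)%:E <=
     (P \x seed_law A)
       [set ws : Omega * seed A |
         let v := [tuple V t ws.1 | t < T] in
         forall t : 'I_T,
           (linfnorm (discrepancy (choices ws.2 v) v t)
            <= C * ln (n * T)%:R ^+ 4)%R])%E.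
Proof.
(* Here 64 is 8 times 8: for [n * T >= 2] the logarithm is at least 1/2, so
   [8 * ln (n * T)%:R ^+ 3 >= 1] lifts the logarithmic threshold to the fourth power. *)
exists (64 * (c + 5)%:R); first by rewrite mulr_gt0// ltr0n addnS.
move=> n T p n_gt0 T_gt0 pball.
exists (balancing_alg n T (8 * (c + 5)%:R * ln (n * T)%:R) (T ^ T)).
set A := balancing_alg _ _ _ _ => d Omega P V [Vp _].
(* For [n * T = 1] the logarithm vanishes, but so does the required probability. *)
have [nT1|nT2] := leqP (n * T) 1.
  have -> : (n * T)%N = 1%N.
    by apply/eqP; rewrite eqn_leq nT1 muln_gt0 n_gt0.
  by rewrite expr1n invr1 subrr.
have ln2 : 2^-1 <= ln (n * T)%:R :> R by apply: half_le_ln; rewrite (ler_nat _ 2).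
set b := _ * ln _ ^+ 4.
have cb : 8 * (c + 5)%:R * ln (n * T)%:R <= b.
  rewrite /b; have k0 : 0 <= (c + 5)%:R :> R by rewrite ler0n.
  have l3 : 8^-1 <= ln (n * T)%:R ^+ 3 :> R.
    rewrite (_ : 8^-1 = 2^-1 ^+ 3); last by field.
    by rewrite lerXn2r// nnegrE; lra.
  rewrite exprS mulrA -[leLHS]mulr1.
  rewrite [leRHS](_ : _ = 8 * (c + 5)%:R * ln (n * T)%:R *
    (8 * ln (n * T)%:R ^+ 3)); last by ring.
  apply: ler_wpM2l; last by lra.
  by rewrite !mulr_ge0//; lra.
have b0 : 0 <= b.
  by apply: le_trans cb; rewrite !mulr_ge0// ?ler0n//; lra.
set S := mkset _.
have SE : S = [set ws : Omega * seed A |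
    let v := [tuple V t ws.1 | t < T] in
    forall t i, `|tnth (discrepancy (choices ws.2 v) v t) i| <= b].
  by apply/seteqP; split => ws; rewrite /S /= => h t; apply/(linfnorm_leP _ b0).
have mS : measurable S.
  rewrite SE; apply: (@measurable_discrepancy_le _ _ _ _ _ _ (fun t => V t)) => t.
  exact: measurable_funP.
(* Each [V t] has law [p], and finitely many null sets are discarded. *)
have good : {ae P, forall w, forall t, l2norm (V t w) <= 1}.
  apply: filter_forall => t.
  have mV : measurable (V t @^-1` [set v | l2norm v <= 1]).
    rewrite -[X in measurable X]setTI.
    by apply: measurable_funP => //; exact: measurable_l2ball.
  exists (~` (V t @^-1` [set v | l2norm v <= 1])); split => //.
    exact: measurableC.
  rewrite probability_setC//.
  have -> : P (V t @^-1` [set v | l2norm v <= 1]) = 1%E.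
    exact: etrans (Vp t _ (measurable_l2ball 1)) pball.
  by rewrite subee.
(* The product measure integrates the seed law of the sections, so it suffices to bound almost every
   section from below. *)
rewrite /product_measure1 -[leLHS]mule1 -(probability_setT P).
rewrite -integral_cst//.
apply: ae_ge0_le_integral => //.
- move=> w _; rewrite lee_fin subr_ge0.
  rewrite invf_le1 ?exprn_gt0 ?ltr0n ?muln_gt0 ?n_gt0//.
  by rewrite exprn_ege1// (ler_nat _ 1) muln_gt0 n_gt0.
- exact: measurable_fun_xsection.
apply: filterS good => w vw _ /=.
have vt t : l2norm (tnth [tuple V t w | t < T] t) <= 1 by rewrite tnth_mktuple.
apply: le_trans (balancing_success c n_gt0 T_gt0 nT2 vt) _.
apply: le_measure => //; rewrite ?inE//.
move=> s /= h; rewrite SE /xsection /= inE /= => t i.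
exact: le_trans (h t i) cb.
Qed.
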